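(* Let $A$ be a self-adjoint operator on a Hilbert space $\mathcal{H}$ and let $\varphi\in\mathcal{H}_{-2}\setminus\mathcal{H}$. Let $\alpha,c\in\mathbb{R}$, let $A_{\alpha,c}=A+\alpha\langle\varphi_c,\cdot\rangle\varphi$, let $\dot A$ be the restriction of $A$ to $\{x\in D(A):\langle\varphi,x\rangle=0\}$, and let $T_\theta$, $\theta\in[0,\pi)$, be the self-adjoint extensions of $\dot A$ built from the unit deficiency vectors $u_\pm$ of $\dot A$. Then $A_{\alpha,c}=T_\theta$, where $$\theta=\frac12\arg\left[-\frac{1+\alpha(c-i)}{1+\alpha(c+i)}\right],$$ with $\arg$ taking values in $[0,2\pi)$.
   Context: $\mathcal{H}$ is a complex Hilbert space, with inner product conjugate-linear in the first argument. For $s\ge 0$, $\mathcal{H}_s=D(|A|^{s/2})$ with norm $\|x\|_s=\|(|A|+I)^{s/2}x\|$, and $\mathcal{H}_{-s}$ is the completion of $\mathcal{H}$ in the norm $\|(|A|+I)^{-s/2}x\|$, identified with the space of bounded functionals on $\mathcal{H}_s$; so $\mathcal{H}_2=D(A)$, and for $\varphi\in\mathcal{H}_{-2}$, $x\in\mathcal{H}_2$, $\langle\varphi,x\rangle$ is the duality pairing, extending the inner product by continuity. For $\varphi\in\mathcal{H}_{-2}$, $(A\pm iI)^{-1}\varphi\in\mathcal{H}$ is defined in the generalized sense: $\langle (A\pm iI)^{-1}\varphi,\eta\rangle=\langle\varphi,(A\mp iI)^{-1}\eta\rangle$ for all $\eta\in\mathcal{H}$. Put $A(A^2+I)^{-1}\varphi:=\frac12[(A-iI)^{-1}\varphi+(A+iI)^{-1}\varphi]\in\mathcal{H}$.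 The operator $\dot A:=A\upharpoonright_{D(\dot A)}$, $D(\dot A)=\{x\in D(A):\langle\varphi,x\rangle=0\}$, is a densely defined closed symmetric operator with deficiency indices $(1,1)$. Its deficiency spaces $\mathrm{Ker}(\dot A^*\mp iI)$ are spanned by $g_{\pm i}=(A\mp iI)^{-1}\varphi$; the unit deficiency vectors are $u_\pm=g_{\pm i}/\|g_{\pm i}\|$. One has $D(\dot A^* )=D(A)\dotplus\mathrm{span}\{A(A^2+I)^{-1}\varphi\}$. For $c\in\mathbb{R}$, the functional $\varphi_c$ on $D(\dot A^* )$ extends $\varphi$ by $\langle\varphi_c,x+bA(A^2+I)^{-1}\varphi\rangle=\langle\varphi,x\rangle+bc$ for $x\in D(A)$, $b\in\mathbb{C}$. The formal expression $A_{\alpha,c}=A+\alpha\langle\varphi_c,\cdot\rangle\varphi$ denotes the operator obtained by restricting $\dot A^*$ to $$D(A_{\alpha,c})=\{x+bA(A^2+I)^{-1}\varphi : x\in D(A),\ b\in\mathbb{C},\ b+\alpha(\langle\varphi,x\rangle+bc)=0\}$$ (for $\alpha\ne0$ the condition reads $\langle\varphi,x\rangle=\gamma b$ with $\gamma=-(\frac1\alpha+c)$; and $A_{0,c}=A$). For $\theta\in[0,\pi)$, $T_\theta$ is the restriction of $\dot A^*$ to $D(T_\theta)=D(\dot A)\dotplus\mathrm{span}\{u_++e^{-2i\theta}u_-\}$, i.e. $T_\theta(x+au_++ae^{-2i\theta}u_-)=\dot Ax+aiu_+-aie^{-2i\theta}u_-$ for $x\in D(\dot A)$, $a\in\mathb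b{C}$.
   Formalization: The stated formula for θ needs the normalization ‖(A−iI)^{-1}φ‖=1 and is proved under it; for general φ in H_{-2}\H it is proved with i replaced by iN, N=‖(A−iI)^{-1}φ‖², since the stated formula fails e.g. for α=1, c=0, N=4. *)

(* Defs.v *)
From HB Require Import structures.
From mathcomp Require Import all_boot all_order all_algebra.
From mathcomp Require Import sesquilinear.
From mathcomp Require Import all_classical all_reals all_analysis.
From mathcomp Require Import complex.

Set Implicit Arguments.
Unset Strict Implicit.
Unset Printing Implicit Defensive.

Import Order.TTheory GRing.Theory Num.Theory.
Import numFieldNormedType.Exports.

Local Open Scope classical_set_scope.
Local Open Scope ring_scope.
Local Open Scope complex_scope.

Section ComplexNumbers.
Context {R : realType}.

Definition iC : R[i] := 0 +i* 1.

Definition expi (t : R) : R[i] := cos t +i* sin t.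

(* For z <> 0 there is exactly one such t. *)
Definition arg (z : R[i]) : R :=
  xget 0 [set t : R | 0 <= t < 2 * pi /\ z = `|z| * expi t].

End ComplexNumbers.

(* The forms of sesquilinear.v are linear in the first argument, the inner
   product used here in the second one. H is a Hilbert space for f when
   `|x| ^+ 2 = inner f x x for all x. *)
Definition inner {R : realType} {H : completeNormedModType R[i]}
  (f : {dot H for Num.conj}) (x y : H) : R[i] := f y x.

Section Operators.
Context {R : realType} {H : completeNormedModType R[i]}.
Context (f : {dot H for Num.conj}).

Local Notation "<[ x , y ]>" := (inner f x y) (at level 0).

(* Unbounded operators in H, and linear relations, are given by their graphs:
   T (x, y) means that x is in the domain of T and T x = y. Equality of
   operators, domains included, is thus equality of sets. *)
Definition operator := set (H * H).

Implicit Types (T S A B : operator) (phi : H -> R[i]).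

Definition dom T : set H := [set x | exists y, T (x, y)].

Definition restrict T (D : set H) : operator := [set p | T p /\ D p.1].

Definition comp_op S T : operator :=
  [set p | exists2 y, T (p.1, y) & S (y, p.2)].

Definition linear_op T : Prop :=
  [/\ T (0, 0),
      forall (a : R[i]) x y x' y',
        T (x, y) -> T (x', y') -> T (a *: x + x', a *: y + y') &
      forall x y y', T (x, y) -> T (x, y') -> y = y'].

Definition adj T : operator :=
  [set p | forall q, T q -> <[p.2, q.1]> = <[p.1, q.2]>].

Definition self_adjoint T : Prop :=
  [/\ linear_op T, dense (dom T) & adj T = T].

(* B = |A| = (A^* A)^(1/2) for a self-adjoint A *)
Definition is_abs A B : Prop :=
  [/\ self_adjoint B,
      forall x y, B (x, y) -> 0 <= <[x, y]> &
      comp_op B B = comp_op A A].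

(* phi is in the space H_{-2} of bounded functionals on H_2 = D(A) for the norm
   ||(|A| + I) x||. Functionals on D(A) are represented by functions on H of
   which only the values on D(A) matter, and phi x stands for the duality
   pairing <phi, x>. The operator |A| exists and is unique. *)
Definition in_Hm2 A phi : Prop :=
  (forall (a : R[i]) x y, dom A x -> dom A y ->
     phi (a *: x + y) = a * phi x + phi y) /\
  exists2 absA, is_abs A absA &
    exists C : R, forall x y, absA (x, y) -> `|phi x| <= C%:C * `|y + x|.

(* phi is in H, h in H being identified with the functional <h, .> *)
Definition in_H A phi : Prop :=
  exists h : H, forall x, dom A x -> phi x = <[h, x]>.

(* (T - z I)^-1 eta *)
Definition resolvent T (z : R[i]) (eta : H) : H :=
  xget 0 [set y | T (y, eta + z *: y)].

(* (A - z I)^-1 phi, as a vector of H *)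
Definition gresolvent A phi (z : R[i]) : H :=
  xget 0 [set g | forall eta, <[g, eta]> = phi (resolvent A z^* eta)].

Definition adot A phi : operator := restrict A [set x | phi x = 0].

(* A (A^2 + I)^-1 phi *)
Definition hvec A phi : H :=
  2^-1 *: (gresolvent A phi iC + gresolvent A phi (- iC)).

(* A_{alpha, c} = A + alpha <phi_c, .> phi, where
   <phi_c, x + b A (A^2 + I)^-1 phi> = <phi, x> + b c *)
Definition rank_one A phi (alpha c : R) : operator :=
  restrict (adj (adot A phi))
    [set w | exists x b, [/\ dom A x, w = x + b *: hvec A phi &
       b + alpha%:C * (phi x + b * c%:C) = 0]].

Definition unitv (g : H) : H := `|g|^-1 *: g.

Definition uplus A phi : H := unitv (gresolvent A phi iC).
Definition uminus A phi : H := unitv (gresolvent A phi (- iC)).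

(* T_theta *)
Definition T_ext A phi (theta : R) : operator :=
  restrict (adj (adot A phi))
    [set w | exists x a, dom (adot A phi) x /\
       w = x + a *: (uplus A phi + expi (- 2 * theta) *: uminus A phi)].

End Operators.

(* Main.v *)
Require Import Defs.
From HB Require Import structures.
From mathcomp Require Import all_boot all_order all_algebra.
From mathcomp Require Import sesquilinear.
From mathcomp Require Import all_classical all_reals all_analysis.
From mathcomp Require Import complex.
From mathcomp Require Import ring lra.

Set Implicit Arguments.
Unset Strict Implicit.
Unset Printing Implicit Defensive.

Import Order.TTheory GRing.Theory Num.Theory.
Import numFieldNormedType.Exports.

Local Open Scope classical_set_scope.
Local Open Scope ring_scope.
Local Open Scope complex_scope.

(** Both operators restrict the same relation, the adjoint of the restricted
    operator, so it is enough to compare the two domains. Write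
    g = (A - i)^-1 phi, g' = (A + i)^-1 phi and h = (g + g') / 2 for the vector
    A (A^2 + I)^-1 phi. The resolvent identity gives g - g' = 2 i p with
    p = (A + i)^-1 g in the domain of A, hence g = h + i p and g' = h - i p;
    moreover phi p = <g, g> = |g|^2 =: N, and |g'| = |g| because p is also
    (A - i)^-1 g'. With e = exp (- 2 i theta) the vector spanning the
    deficiency part of T_theta is therefore proportional to
    (1 + e) h + i (1 - e) p. The domain of T_theta thus consists of the vectors
    y + b h, with y in the domain of A, such that for some s
       b = (1 + e) s   and   phi y = i (1 - e) N s.
    The domain of A_(alpha, c) consists of the y + b h with
    b (1 + alpha c) + alpha phi y = 0. The two conditions define the same
    complex line exactly when e = - D / conj D with D = 1 + alpha (c + i N)
    (boundary_condition), which is the formula for theta.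

    What remains is to see that the objects involved exist. Everything of this
    kind comes from one representation theorem (riesz): a bounded linear
    functional on a linear subspace, not necessarily closed, of a Hilbert space
    is the inner product with a vector. It yields
    - the surjectivity of A - z for z = i and z = - i (shift_onto), by
      representing (A + z) x |-> <eta, x>;
    - the inclusion of the domain of A in that of |A|, with a bound
      (abs_bound), by representing y |-> <x, |A| y>;
    - the vectors (A - z)^-1 phi (gresolventP), by representing
      eta |-> phi ((A + z)^-1 eta), which is bounded because phi is bounded
      in the norm of (|A| + I) x. *)

(** * Norms with real values *)

Section RealNorm.
Context {R : realType}.
Implicit Types (V : normedZmodType R[i]) (z : R[i]).

(** Norms over R[i] have values in R[i], which is only partially ordered; their
    real parts carry the same information and live in a totally ordered field. *)
Definition rnorm V (x : V) : R := complex.Re `|x|.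

Lemma rnormE V (x : V) : `|x| = (rnorm x)%:C.
Proof. by rewrite /rnorm RRe_real ?normr_real. Qed.

Lemma rnorm_ge0 V (x : V) : 0 <= rnorm x.
Proof. by rewrite -lecR -rnormE normr_ge0. Qed.

Lemma rnorm_eq0 V (x : V) : (rnorm x == 0) = (x == 0).
Proof. by rewrite -[RHS]normr_eq0 rnormE -[LHS](inj_eq (@complexI R)). Qed.

Lemma rnorm0 V : rnorm (0 : V) = 0.
Proof. by rewrite /rnorm normr0. Qed.

Lemma rnormD V (x y : V) : rnorm (x + y) <= rnorm x + rnorm y.
Proof. by rewrite -lecR rmorphD /= -!rnormE ler_normD. Qed.

Lemma rnormN V (x : V) : rnorm (- x) = rnorm x.
Proof. by rewrite /rnorm normrN. Qed.

Lemma rnormM (z w : R[i]) : rnorm (z * w) = rnorm z * rnorm w.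
Proof. by apply: complexI; rewrite rmorphM /= -!rnormE normrM. Qed.

Lemma rnormJ z : rnorm (conjc z) = rnorm z.
Proof. by apply: complexI; rewrite -!rnormE normcJ. Qed.

Lemma rnorm_sqr z : (rnorm z ^+ 2)%:C = z * conjc z.
Proof. by rewrite rmorphXn /= -rnormE sqr_normc. Qed.

Lemma Re_le_rnorm z : complex.Re z <= rnorm z.
Proof.
by rewrite -lecR -rnormE; apply: le_trans (normc_ge_Re z); rewrite lecR ler_norm.
Qed.

Lemma rnorm_real (x : R) : rnorm x%:C = `|x|.
Proof. by rewrite /rnorm normc_def /= expr0n addr0 sqrtr_sqr. Qed.

(** The quadratic function of a on the left is evaluated at the negative
    multiple t of conj d that minimizes it, t = 1 / K^2; if K = 0, it is affine
    and can only be bounded below when d = 0. *)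
Lemma quadratic_bound (E K : R) (d : R[i]) :
  (forall a : R[i], 0 <= E + (rnorm a * K) ^+ 2 + 2 * complex.Re (a * d)) ->
  rnorm d ^+ 2 <= E * K ^+ 2.
Proof.
move=> pos.
have {}pos t : 0 <= t ->
    0 <= E + rnorm d ^+ 2 * (t * K) ^+ 2 - 2 * t * rnorm d ^+ 2.
  move=> t0; have := pos (- (conjc d * t%:C)).
  rewrite (_ : _ * d = (- (rnorm d ^+ 2 * t))%:C) /=; last first.
    by rewrite rmorphN rmorphM /= rnorm_sqr; ring.
  by rewrite rnormN rnormM rnormJ rnorm_real ger0_norm//; lra.
have [K0|K0] := eqVneq K 0; last first.
  have K2 : 0 < K ^+ 2 by rewrite exprn_even_gt0.
  rewrite -ler_pdivrMr//.
  have := pos (K ^+ 2)^-1; rewrite invr_ge0 ltW// => /(_ isT).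
  rewrite (_ : (_ * K) ^+ 2 = (K ^+ 2)^-1); last by field.
  lra.
rewrite K0 expr0n mulr0; have [-> //|d0] := eqVneq (rnorm d ^+ 2) 0.
have dd : 0 < rnorm d ^+ 2 by rewrite lt0r d0 sqr_ge0.
have t0 : 0 <= (`|E| + 1) / rnorm d ^+ 2 by rewrite divr_ge0 ?addr_ge0 ?(ltW dd).
have := pos _ t0; rewrite K0 !mulr0 expr0n mulr0 addr0 -mulrA divfK//.
by have := ler_norm E; have := normr_ge0 E; lra.
Qed.

End RealNorm.

(** * Inner product *)

Section InnerProduct.
Context {R : realType} {H : completeNormedModType R[i]}.
Context (f : {dot H for Num.conj}).
Context (norm_inner : forall x : H, `|x| ^+ 2 = inner f x x).

Local Notation "<[ x , y ]>" := (inner f x y) (at level 0).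
Implicit Types (x y : H) (a : R[i]).

Lemma rnormZ a x : rnorm (a *: x) = rnorm a * rnorm x.
Proof. by apply: complexI; rewrite rmorphM /= -!rnormE normrZ. Qed.

Lemma innerC x y : <[x, y]> = conjc <[y, x]>.
Proof. by rewrite /inner hermC expr0 mul1r. Qed.

Lemma innerDr x y z : <[x, y + z]> = <[x, y]> + <[x, z]>.
Proof. exact: linearDl. Qed.

Lemma innerZr a x y : <[x, a *: y]> = a * <[x, y]>.
Proof. by rewrite /inner linearZl. Qed.

Lemma innerNr x y : <[x, - y]> = - <[x, y]>.
Proof. exact: linearNl. Qed.

Lemma innerBr x y z : <[x, y - z]> = <[x, y]> - <[x, z]>.
Proof. exact: linearBl. Qed.

Lemma inner0r x : <[x, 0]> = 0.
Proof. exact: linear0l. Qed.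

Lemma inner0l x : <[0, x]> = 0.
Proof. exact: linear0r. Qed.

Lemma innerDl x y z : <[x + y, z]> = <[x, z]> + <[y, z]>.
Proof. exact: linearDr. Qed.

Lemma innerZl a x y : <[a *: x, y]> = conjc a * <[x, y]>.
Proof. by rewrite innerC innerZr rmorphM /= -innerC. Qed.

Lemma innerBl x y z : <[x - y, z]> = <[x, z]> - <[y, z]>.
Proof. exact: linearBr. Qed.

Lemma innerxx x : <[x, x]> = (rnorm x ^+ 2)%:C.
Proof. by rewrite -norm_inner rnormE rmorphXn. Qed.

Lemma inner_ext x y : (forall z, <[x, z]> = <[y, z]>) -> x = y.
Proof.
move=> xy; apply/eqP; rewrite -subr_eq0 -rnorm_eq0 -sqrf_eq0.
by rewrite -(inj_eq (@complexI R)) -innerxx innerBl xy subrr.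
Qed.

Lemma rnorm_sqrD x y :
  rnorm (x + y) ^+ 2 = rnorm x ^+ 2 + rnorm y ^+ 2 + 2 * complex.Re <[x, y]>.
Proof.
apply: complexI; rewrite -innerxx innerDr !innerDl !innerxx (innerC y x).
have := addcJ <[x, y]>; move: <[x, y]> => z zJ.
by rewrite !rmorphD [X in _ = _ + X]rmorphM rmorph_nat -zJ; ring.
Qed.

Lemma rnorm_innerM x y : rnorm <[x, y]> <= rnorm x * rnorm y.
Proof.
rewrite -ler_sqr ?nnegrE ?mulr_ge0 ?rnorm_ge0// exprMn.
apply: quadratic_bound => a.
by rewrite -innerZr -rnormZ -rnorm_sqrD sqr_ge0.
Qed.

End InnerProduct.

(** * Representation of bounded functionals *)

Section Riesz.
Context {R : realType} {H : completeNormedModType R[i]}.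
Context (f : {dot H for Num.conj}).
Context (norm_inner : forall x : H, `|x| ^+ 2 = inner f x x).

Local Notation "<[ x , y ]>" := (inner f x y) (at level 0).

Context (G : set (H * R[i])) (M : R).
Context (G0 : G (0, 0)).
Context (GD : forall a x s y t,
  G (x, s) -> G (y, t) -> G (a *: x + y, a * s + t)).
Context (M0 : 0 <= M).
Context (GM : forall x s, G (x, s) -> rnorm s <= M * rnorm x).

(** If h represents the functional s of x on the graph G, this is
    |x - h|^2 - |h|^2: the infimum is approached when x tends to the projection
    of h on the closure of the subspace. *)
Let energy (p : H * R[i]) : R := rnorm p.1 ^+ 2 - 2 * complex.Re p.2.
Let m := inf (energy @` G).

Let has_inf_energy : has_inf (energy @` G).
Proof.
split; first by exists (energy (0, 0)), (0, 0).
exists (- M ^+ 2) => _ [[x s] /GM xs <-]; rewrite /energy /=.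
have := sqr_ge0 (rnorm x - M); have := Re_le_rnorm s; nra.
Qed.

Let energy_ge p : G p -> m <= energy p.
Proof. by move=> Gp; apply: (ge_inf has_inf_energy.2); exists p. Qed.

Let energyD x s y t :
  energy (x + y, s + t) =
  energy (x, s) + rnorm y ^+ 2 + 2 * complex.Re (<[x, y]> - t).
Proof.
by rewrite /energy /= (rnorm_sqrD norm_inner) raddfD raddfB /=; ring.
Qed.

(** Moving from (x, s) along (y, t) can lower the energy by e^2 at most. *)
Let almost_represents (e : R) x s y t : 0 <= e -> G (x, s) ->
  energy (x, s) <= m + e ^+ 2 -> G (y, t) ->
  rnorm (<[x, y]> - t) <= e * rnorm y.
Proof.
move=> e0 Gx xe Gy; rewrite -ler_sqr ?nnegrE ?mulr_ge0 ?rnorm_ge0// exprMn.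
apply: quadratic_bound => a; have := energy_ge (GD a Gy Gx).
rewrite addrC [X in (_, X)]addrC energyD rnormZ innerZr -mulrBr.
by move: xe; lra.
Qed.

(** Parallelogram law: 4 energy (midpoint) + |x - y|^2 is twice the sum of the
    two energies, and the midpoint has energy at least m. *)
Let almost_minimizers_close e x s y t : G (x, s) -> G (y, t) ->
  energy (x, s) <= m + e -> energy (y, t) <= m + e ->
  rnorm (x - y) ^+ 2 <= 4 * e.
Proof.
move=> Gx Gy xe ye; have half : G (2^-1%:C *: (x + y), 2^-1%:C * (s + t)).
  have /= := GD 2^-1%:C (GD 1 Gx Gy) G0.
  by rewrite scale1r mul1r !addr0.
have := energy_ge half; move: xe ye; rewrite /energy /= rnormZ rnorm_real.
rewrite ger0_norm ?invr_ge0//.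
have -> : complex.Re (2^-1%:C * (s + t)) = 2^-1 * (complex.Re s + complex.Re t).
  by rewrite -raddfD /=; case: (s + t) => u v /=; rewrite mul0r subr0.
rewrite (rnorm_sqrD norm_inner x (- y)) innerNr rnormN raddfN exprMn.
by rewrite (rnorm_sqrD norm_inner) /=; lra.
Qed.

Let minimizing (n : nat) : {p | G p & energy p <= m + n.+1%:R^-1}.
Proof.
apply: cid2; have n0 : (0 : R) < n.+1%:R^-1 by rewrite invr_gt0 ltr0n.
have [_ [p Gp <-] pn] := inf_adherent n0 has_inf_energy.
by exists p => //; exact: ltW.
Qed.

Let u n : H := (s2val (minimizing n)).1.

Let archi (e : R) : 0 < e -> exists n, n.+1%:R^-1 < e.
Proof.
move=> e0; have [n _ h] := near_infty_natSinv_lt (PosNum e0).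
by exists n; apply: h => /=.
Qed.

Let near_u n k : (n <= k)%N -> G (u k, (s2val (minimizing k)).2) /\
   energy (u k, (s2val (minimizing k)).2) <= m + n.+1%:R^-1.
Proof.
rewrite /u; case: minimizing => -[x s] /= Gx xk nk; split => //.
by apply: le_trans xk _; rewrite lerD2l lef_pV2 ?posrE ?ltr0n// ler_nat.
Qed.

Let cvg_u : cvgn u.
Proof.
apply: cauchy_cvg; apply: cauchy_exP => e e0.
have ee : e = (complex.Re e)%:C by rewrite RRe_real// gtr0_real.
have r0 : 0 < complex.Re e by rewrite -ltcR -ee.
have [n hn] : exists n, n.+1%:R^-1 < complex.Re e ^+ 2 / 4.
  by apply: archi; rewrite divr_gt0// exprn_gt0.
exists (u n), n => // k /= nk; rewrite -ball_normE /= rnormE ee ltcR.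
have [Gn en] := near_u (leqnn n); have [Gk ek] := near_u nk.
rewrite -ltr_sqr ?nnegrE ?rnorm_ge0 ?(ltW r0)//.
apply: le_lt_trans (almost_minimizers_close Gn Gk en ek) _.
by rewrite mulrC -ltr_pdivlMr.
Qed.

Let limit_approx (e : R) : 0 < e -> exists2 p, G p &
  energy p <= m + e ^+ 2 /\ rnorm (lim (u @ \oo) - p.1) <= e.
Proof.
move=> e0; have [n hn] := archi (exprn_gt0 2 e0).
have := cvg_u; move=> /cvgrPdist_lt /(_ e%:C); rewrite ltcR => /(_ e0) [k _ hk].
have := hk (maxn n k) (leq_maxr _ _); rewrite rnormE ltcR => /ltW uk.
have [Gu eu] := near_u (leq_maxl n k).
exists (u (maxn n k), (s2val (minimizing (maxn n k))).2) => //.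
by split => //; apply: le_trans eu _; rewrite lerD2l ltW.
Qed.

(** The limit h of a minimizing sequence, which is Cauchy by the parallelogram
    law; since h is a limit of elements of the subspace, on which it acts with
    norm at most M, also |h|^2 <= M |h|. *)
Lemma riesz : exists2 h : H,
  rnorm h <= M & forall x s, G (x, s) -> s = <[h, x]>.
Proof.
set h := lim (u @ \oo).
have repr x s : G (x, s) -> s = <[h, x]>.
  move=> Gx; apply/eqP; rewrite -subr_eq0 -rnorm_eq0 eq_le rnorm_ge0 andbT.
  apply/ler_addgt0Pl => e e0; rewrite addr0.
  pose e1 := e / (2 * (rnorm x + 1)).
  have K0 := rnorm_ge0 x.
  have e10 : 0 < e1 by rewrite divr_gt0//; lra.
  have [[y t] Gy [ye hy]] := limit_approx e10.
  have h1 := almost_represents (ltW e10) Gy ye Gx.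
  have h2 := le_trans (rnorm_innerM norm_inner (h - y) x) (ler_wpM2r K0 hy).
  have -> : s - <[h, x]> = - (<[y, x]> - s) - <[h - y, x]>.
    by rewrite innerBl; ring.
  apply: le_trans (rnormD _ _) _; rewrite !rnormN.
  have -> : e = e1 * (2 * (rnorm x + 1)) by rewrite /e1 divfK// gt_eqF//; lra.
  nra.
exists h => //; have [->|h0] := eqVneq h 0; first by rewrite rnorm0.
have K0 : 0 < rnorm h by rewrite lt0r rnorm_eq0 h0 rnorm_ge0.
rewrite -(ler_pM2r K0); apply/ler_addgt0Pl => e e0.
have hM0 : 0 < rnorm h + M by apply: ltr_wpDr.
pose e1 := e / (rnorm h + M).
have e10 : 0 < e1 by rewrite divr_gt0.
have [[y t] Gy [_ hy]] := limit_approx e10.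
rewrite /= -/h in hy.
have h1 := le_trans (rnorm_innerM norm_inner h (h - y)) (ler_wpM2l (ltW K0) hy).
have h2 := GM Gy; rewrite (repr _ _ Gy) in h2.
have h3 : rnorm y <= rnorm h + e1.
  have -> : y = h - (h - y) by rewrite subKr.
  by apply: le_trans (rnormD _ _) _; rewrite rnormN lerD2l.
have -> : rnorm h * rnorm h = complex.Re (<[h, h - y]> + <[h, y]>).
  by rewrite -innerDr subrK (innerxx norm_inner) /= expr2.
apply: le_trans (Re_le_rnorm _) _; apply: le_trans (rnormD _ _) _.
have -> : e = e1 * (rnorm h + M) by rewrite /e1 divfK// gt_eqF.
have h4 := ler_wpM2l M0 h3; lra.
Qed.

End Riesz.

(** * Resolvents of self-adjoint operators at i and - i *)

Section SelfAdjoint.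
Context {R : realType} {H : completeNormedModType R[i]}.
Context (f : {dot H for Num.conj}).
Context (norm_inner : forall x : H, `|x| ^+ 2 = inner f x x).

Local Notation "<[ x , y ]>" := (inner f x y) (at level 0).

(** The solutions are i and - i; this form treats both signs together. *)
Definition imaginary_unit (z : R[i]) := z^* = - z /\ rnorm z = 1.

Lemma imaginary_unitN z : imaginary_unit z -> imaginary_unit (- z).
Proof. by move=> [zJ z1]; rewrite /imaginary_unit rmorphN /= zJ rnormN. Qed.

Lemma imaginary_unit_iC : imaginary_unit iC.
Proof.
split; first by apply/eqP; rewrite eq_complex /= oppr0 !eqxx.
by rewrite /rnorm normc_def /= expr0n expr1n add0r sqrtr1.
Qed.

Section Resolvent.
Context (A : @operator R H).
Context (A_sa : self_adjoint f A).

Lemma op_lin a x y x' y' :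
  A (x, y) -> A (x', y') -> A (a *: x + x', a *: y + y').
Proof. by case: A_sa => -[_ lin _] _ _; apply: lin. Qed.

Lemma opB x y x' y' : A (x, y) -> A (x', y') -> A (x - x', y - y').
Proof.
by move=> Ax Ax'; have := op_lin (-1) Ax' Ax; rewrite !scaleN1r ![- _ + _]addrC.
Qed.

Lemma op_sym x x' y y' : A (x, x') -> A (y, y') -> <[x', y]> = <[x, y']>.
Proof.
have [_ _ Aadj] := A_sa.
by move=> Ax Ay; move: Ax; rewrite -Aadj => /(_ (y, y') Ay).
Qed.

Lemma op_adj x h : (forall y y', A (y, y') -> <[h, y]> = <[x, y']>) -> A (x, h).
Proof. by move=> hx; case: A_sa => _ _ <- [y y'] /hx. Qed.

(** The cross term is the real part of - z <y, x>, which is imaginary because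
    <A x, x> is real. *)
Lemma shift_rnorm z x y : imaginary_unit z -> A (x, y) ->
  rnorm (y - z *: x) ^+ 2 = rnorm y ^+ 2 + rnorm x ^+ 2.
Proof.
move=> [zJ z1] Ax; rewrite (rnorm_sqrD norm_inner) rnormN rnormZ z1 mul1r.
have yx : <[y, x]> = <[y, x]>^* by rewrite [LHS](op_sym Ax Ax) innerC.
rewrite innerNr innerZr.
suff -> : complex.Re (- (z * <[y, x]>)) = 0 by rewrite mulr0 addr0.
set w := - _; have : w^* = - w.
  by rewrite /w rmorphN rmorphM /= -yx zJ mulNr.
by case: w => u v [] /eqP; rewrite -addr_eq0 -mulr2n mulrn_eq0 /= => /eqP.
Qed.

Lemma shift_ge z x y : imaginary_unit z -> A (x, y) ->
  rnorm x <= rnorm (y - z *: x) /\ rnorm y <= rnorm (y - z *: x).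
Proof.
move=> hz /(shift_rnorm hz) e; split;
  rewrite -ler_sqr ?nnegrE ?rnorm_ge0// e ?lerDl ?lerDr sqr_ge0 //.
Qed.

(** The functional y + z x |-> <eta, x> on the range of A + z is bounded because
    |x| <= |A x + z x|; that h represents it says (A^* - z) h = eta. *)
Lemma shift_onto z eta : imaginary_unit z -> exists x, A (x, eta + z *: x).
Proof.
move=> hz; have [zJ _] := hz.
pose G : set (H * R[i]) :=
  [set p | exists x y, [/\ A (x, y), p.1 = y + z *: x & p.2 = <[eta, x]>]].
have A0 : A (0, 0) by case: A_sa => -[].
have [|a x s y t [x1 [x2 [Ax /= -> ->]]] [y1 [y2 [Ay /= -> ->]]]|x s|h _ hG] :=
    @riesz _ _ f norm_inner G (rnorm eta) _ _ (rnorm_ge0 _).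
- by exists 0, 0; rewrite /= scaler0 addr0 inner0r.
- exists (a *: x1 + y1), (a *: x2 + y2); split => /=.
  + exact: op_lin.
  + by rewrite !scalerDr !scalerA [a * z]mulrC !addrA; congr (_ + _); rewrite addrAC.
  + by rewrite innerDr innerZr.
- move=> [x1 [x2 [Ax /= -> ->]]]; apply: le_trans (rnorm_innerM norm_inner _ _) _.
  rewrite ler_wpM2l ?rnorm_ge0//.
  by have [+ _] := shift_ge (imaginary_unitN hz) Ax; rewrite scaleNr opprK.
exists h; apply: op_adj => y y' Ay.
rewrite innerDl innerZl zJ (hG (y' + z *: y) <[eta, y]>); last by exists y, y'.
by rewrite innerDr innerZr mulNr addrK.
Qed.

Lemma resolventP z eta : imaginary_unit z ->
  A (resolvent A z eta, eta + z *: resolvent A z eta).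
Proof.
move=> /(shift_onto eta) [x Ax].
by apply: (xgetPex 0 (P := [set y | A (y, eta + z *: y)])); exists x.
Qed.

Lemma resolvent_unique z eta x : imaginary_unit z ->
  A (x, eta + z *: x) -> resolvent A z eta = x.
Proof.
move=> hz Ax; have := opB (resolventP eta hz) Ax.
rewrite opprD addrACA subrr add0r -scalerBr => /(shift_ge hz)[+ _].
rewrite subrr rnorm0 => h; apply/eqP; rewrite -subr_eq0 -rnorm_eq0.
by rewrite eq_le rnorm_ge0 h.
Qed.

Lemma resolvent_le z eta : imaginary_unit z ->
  rnorm (resolvent A z eta) <= rnorm eta /\
  rnorm (eta + z *: resolvent A z eta) <= rnorm eta.
Proof. by move=> hz; have := shift_ge hz (resolventP eta hz); rewrite addrK. Qed.

Lemma resolvent_adj z eta xi : imaginary_unit z ->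
  <[resolvent A (- z) xi, eta]> = <[xi, resolvent A z eta]>.
Proof.
move=> hz; have := op_sym (resolventP xi (imaginary_unitN hz)) (resolventP eta hz).
have [zJ _] := hz.
rewrite innerDl innerDr innerZl innerZr rmorphN /= zJ opprK.
by move=> /addIr.
Qed.

(** First resolvent identity at the two points z and - z. *)
Lemma resolventB z eta : imaginary_unit z ->
  resolvent A (- z) eta - resolvent A z eta =
  (- (2 * z)) *: resolvent A (- z) (resolvent A z eta).
Proof.
move=> hz; have hNz := imaginary_unitN hz.
set x := resolvent A z eta.
have := op_lin (- (2 * z)) (resolventP x hNz) (resolventP eta hz).
rewrite -/x => Ap; apply/eqP; rewrite subr_eq; apply/eqP.
apply: resolvent_unique => //; move: Ap; congr (A (_, _)).
set y := resolvent A (- z) x.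
rewrite !scalerDr !scalerA addrCA; congr (_ + _).
by rewrite addrAC -scalerDl addrC; congr (_ *: _ + _ *: _); ring.
Qed.

End Resolvent.

(** * Comparison of A with its absolute value *)

Section AbsoluteValue.
Context (A B : @operator R H).
Context (A_sa : self_adjoint f A).
Context (AB : is_abs f A B).

Let B_sa : self_adjoint f B. Proof. by case: AB. Qed.

(** The vector w = B y equals (A^2 + I) p = (B^2 + I) p for some p, because
    A^2 + I = (A - i) (A + i) is onto. Then <x, w> = <A x, A p> + <x, p>, where
    |A p|^2 + |p|^2 = <p, w> = |B p|^2 + |p|^2, and
    <p, w> = <B p, y> <= |B p| |y|; hence |B p| <= |y|, and |p|, |A p| <= |y|. *)
Let abs_weak_bound x x' y w : A (x, x') -> B (y, w) ->
  rnorm <[x, w]> <= (rnorm x' + rnorm x) * rnorm y.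
Proof.
move=> Ax Byw; have [_ _ BB] := AB; have i1 := imaginary_unit_iC.
have [q Aq] := shift_onto A_sa w i1.
have [p Ap] := shift_onto A_sa q (imaginary_unitN i1).
set r := q + _ in Ap.
have App : A (r, w - p).
  have := op_lin A_sa (- iC) Ap Aq; rewrite [_ + q]addrC -/r; congr (A (_, _)).
  rewrite addrCA; congr (_ + _); rewrite /r scalerDr scaleNr addrC addNKr scalerA.
  rewrite mulrNN (_ : iC * iC = -1) ?scaleN1r//.
  by apply/eqP; rewrite eq_complex /= !mul0r !mulr0 mulr1 sub0r addr0 oppr0 !eqxx.
have [v Bp Bv] : comp_op B B (p, w - p) by rewrite BB; exists r.
have pp : rnorm p ^+ 2 = complex.Re <[p, p]> by rewrite (innerxx norm_inner).
(* |T p|^2 + |p|^2 = <p, (T^2 + I) p>, for T = A and for T = B *)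
have energy T t : self_adjoint f T -> T (p, t) -> T (t, w - p) ->
    rnorm t ^+ 2 + rnorm p ^+ 2 = complex.Re <[p, w]>.
  move=> T_sa Tp Tt; have := op_sym T_sa Tp Tt.
  rewrite (innerxx norm_inner) innerBr => /(congr1 (@complex.Re R)).
  by rewrite raddfB /= -pp => ->; rewrite subrK.
have er := energy _ _ A_sa Ap App; have ev := energy _ _ B_sa Bp Bv.
have pw : complex.Re <[p, w]> <= rnorm v * rnorm y.
  rewrite -(op_sym B_sa Bp Byw); apply: le_trans (Re_le_rnorm _) _.
  exact: rnorm_innerM.
have [v0 y0 p0 r0] := And4 (rnorm_ge0 v) (rnorm_ge0 y) (rnorm_ge0 p) (rnorm_ge0 r).
have vy : rnorm v <= rnorm y by nra.
have py : rnorm p <= rnorm y by nra.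
have ry : rnorm r <= rnorm y by nra.
rewrite -[w](subrK p) innerDr -(op_sym A_sa Ax App).
apply: le_trans (rnormD _ _) _; rewrite mulrDl.
by rewrite lerD// (le_trans (rnorm_innerM norm_inner _ _))// ler_wpM2l// rnorm_ge0.
Qed.

(** The functional y |-> <x, B y> being bounded, x is in the domain of the
    adjoint of B, which is B. *)
Lemma abs_bound x x' : A (x, x') ->
  exists2 h, B (x, h) & rnorm h <= rnorm x' + rnorm x.
Proof.
move=> Ax.
pose G : set (H * R[i]) := [set p | exists2 w, B (p.1, w) & p.2 = <[x, w]>].
have M0 : 0 <= rnorm x' + rnorm x by rewrite addr_ge0 ?rnorm_ge0.
have [|a y s z t [w Bw /= ->] [w' Bw' /= ->]|y s [w Bw /= ->]|h hM hG] :=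
    @riesz _ _ f norm_inner G (rnorm x' + rnorm x) _ _ M0.
- by exists 0; [case: B_sa => -[]|rewrite inner0r].
- exists (a *: w + w') => /=; first exact: (op_lin B_sa).
  by rewrite innerDr innerZr.
- exact: abs_weak_bound.
exists h => //; apply: (op_adj B_sa) => y w Byw.
by rewrite -(hG y <[x, w]>)//; exists w.
Qed.

End AbsoluteValue.

(** * Resolvents applied to a functional in H_(-2) *)

Section SingularFunctional.
Context (A : @operator R H) (phi : H -> R[i]).
Context (A_sa : self_adjoint f A).
Context (phi_Hm2 : in_Hm2 f A phi).

Lemma functionalZD a x y : dom A x -> dom A y ->
  phi (a *: x + y) = a * phi x + phi y.
Proof. by case: phi_Hm2 => lin _; apply: lin. Qed.

Lemma dom_resolvent z eta : imaginary_unit z -> dom A (resolvent A z eta).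
Proof. by move=> hz; eexists; apply: resolventP. Qed.

Lemma functional_bound : exists2 C : R, 0 <= C &
  forall x y, A (x, y) -> rnorm (phi x) <= C * (rnorm y + rnorm x).
Proof.
have [_ [B AB [C CB]]] := phi_Hm2.
exists (2 * `|C|) => [|x y Ax]; first by rewrite mulr_ge0.
have [h Bh hxy] := abs_bound A_sa AB Ax.
have := CB _ _ Bh; rewrite !rnormE -rmorphM lecR => /le_trans; apply.
have := rnormD h x; have := ler_norm C; have := normr_ge0 C.
have [x0 y0 h0] := And3 (rnorm_ge0 (h + x)) (rnorm_ge0 x) (rnorm_ge0 y).
move=> C0 CC hx; apply: (@le_trans _ _ (`|C| * rnorm (h + x))).
  exact: ler_wpM2r.
by rewrite -mulrA mulrCA ler_wpM2l//; lra.
Qed.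

Lemma gresolventP z eta : imaginary_unit z ->
  <[gresolvent f A phi z, eta]> = phi (resolvent A (- z) eta).
Proof.
move=> hz; have [zJ _] := hz; have hNz := imaginary_unitN hz.
rewrite -zJ in hNz *.
suff [g hg] : exists g, forall eta, <[g, eta]> = phi (resolvent A z^* eta).
  pose P : set H := [set g | forall eta, <[g, eta]> = phi (resolvent A z^* eta)].
  exact: (xgetPex 0 (P := P) (ex_intro _ g hg)).
pose G : set (H * R[i]) := [set p | p.2 = phi (resolvent A z^* p.1)].
have [C C0 bC] := functional_bound.
have RD a x y : resolvent A z^* (a *: x + y) =
    a *: resolvent A z^* x + resolvent A z^* y.
  apply: (resolvent_unique A_sa) => //.
  have := op_lin A_sa a (resolventP A_sa x hNz) (resolventP A_sa y hNz).
  by rewrite !scalerDr !scalerA [a * _]mulrC addrACA.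
have GD a x s y t : G (x, s) -> G (y, t) -> G (a *: x + y, a * s + t).
  rewrite /G /= => -> ->; rewrite RD functionalZD//; exact: dom_resolvent.
have [||x s|g _ hG] :=
    @riesz _ _ f norm_inner G (C * 2) _ GD.
- rewrite /G /=; pose s := phi (resolvent A z^* 0).
  have := GD (-1) 0 s 0 s erefl erefl.
  by rewrite /G /= scaler0 addr0 mulN1r addNr.
- by rewrite mulr_ge0.
- rewrite /G /= => ->; apply: le_trans (bC _ _ (resolventP A_sa x hNz)) _.
  by have [? ?] := resolvent_le A_sa x hNz; rewrite -mulrA ler_wpM2l//; lra.
by exists g => eta'; rewrite -(hG eta' (phi (resolvent A z^* eta'))).
Qed.

(** The resolvent identity for vectors, resolventB, carried over by duality. *)
Lemma gresolventB z : imaginary_unit z ->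
  gresolvent f A phi z - gresolvent f A phi (- z) =
  (2 * z) *: resolvent A (- z) (gresolvent f A phi z).
Proof.
move=> hz; have hNz := imaginary_unitN hz; apply: (inner_ext norm_inner) => eta.
rewrite innerBl !gresolventP// opprK innerZl (resolvent_adj A_sa)// gresolventP//.
have [zJ _] := hz; rewrite rmorphM rmorph_nat /= zJ mulrN.
have := resolventB A_sa eta hz => /eqP; rewrite subr_eq => /eqP ->.
by rewrite functionalZD ?addrK//; exact: dom_resolvent.
Qed.

Lemma functional_resolvent z : imaginary_unit z ->
  phi (resolvent A (- z) (gresolvent f A phi z)) =
  (rnorm (gresolvent f A phi z) ^+ 2)%:C.
Proof. by move=> hz; rewrite -gresolventP// (innerxx norm_inner). Qed.

(** Every x in the domain of A is (A + z)^-1 of some vector, on which phi is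
    given by the inner product with (A - z)^-1 phi. *)
Lemma gresolvent_neq0 z : imaginary_unit z -> ~ in_H f A phi ->
  gresolvent f A phi z != 0.
Proof.
move=> hz nH; apply/eqP => g0; apply: nH; exists 0 => x [y Ax].
have := gresolventP (y + z *: x) hz; rewrite g0 !inner0l => ->; congr phi.
apply/esym; apply: (resolvent_unique A_sa) (imaginary_unitN hz) _.
by rewrite scaleNr addrK.
Qed.

(** The difference of the two generalized resolvents can be computed from either
    of them. *)
Lemma resolvent_gresolventN z : imaginary_unit z ->
  resolvent A z (gresolvent f A phi (- z)) =
  resolvent A (- z) (gresolvent f A phi z).
Proof.
move=> hz; have hNz := imaginary_unitN hz.
have := gresolventB hNz; rewrite opprK -opprB gresolventB// mulrN scaleNr.
have z0 : 2 * z != 0.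
  rewrite mulf_neq0 ?pnatr_eq0// -rnorm_eq0; case: hz => _ ->; exact: oner_neq0.
by move=> /oppr_inj /(scalerI z0).
Qed.

Lemma rnorm_gresolventN z : imaginary_unit z ->
  rnorm (gresolvent f A phi (- z)) = rnorm (gresolvent f A phi z).
Proof.
move=> hz; have := functional_resolvent (imaginary_unitN hz).
rewrite opprK resolvent_gresolventN// functional_resolvent// => /complexI /esym.
by move=> /eqP; rewrite eqrXn2 ?rnorm_ge0// => /eqP.
Qed.

End SingularFunctional.
End SelfAdjoint.

(** * The angle and the boundary condition *)

Lemma expi_conj {R : realType} (t : R) : expi (- t) = conjc (expi t).
Proof. by rewrite /expi cosN sinN. Qed.

Lemma expi_arg {R : realType} (w : R[i]) : rnorm w = 1 -> w = expi (arg w).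
Proof.
move=> w1.
suff [t [t_range wt]] : exists t : R, 0 <= t < 2 * pi /\ w = expi t.
  have [_ {1}->] : 0 <= arg w < 2 * pi /\ w = `|w| * expi (arg w).
    pose P := [set t : R | 0 <= t < 2 * pi /\ w = `|w| * expi t].
    apply: (xgetPex 0 (P := P)).
    by exists t; rewrite /P /= rnormE w1 mul1r.
  by rewrite rnormE w1 mul1r.
case: w w1 => u v w1.
have uv : u ^+ 2 + v ^+ 2 = 1.
  by apply: complexI; rewrite -(expr1n _ 2) -w1 rmorphXn /= -rnormE -add_Re2_Im2.
have u1 : -1 <= u <= 1 by apply/andP; split; nra.
have cu : cos (acos u) = u by rewrite acosK// in_itv.
have su : sin (acos u) = `|v|.
  by rewrite sin_acos// -uv addrAC subrr add0r sqrtr_sqr.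
have a0 := acos_ge0 u1; have api := acos_lepi u1; have pi0 := pi_gt0 R.
have [v0|v0] := leP 0 v.
  exists (acos u); split; first by lra.
  by rewrite /expi cu su ger0_norm.
have u_lt1 : u < 1 by nra.
have agt0 : 0 < acos u by apply: acos_gt0; case/andP: u1 => -> _.
exists (- acos u + pi *+ 2); split; first by lra.
by rewrite /expi cosD2pi sinD2pi cosN sinN cu su ltr0_norm// opprK.
Qed.

Lemma conj_denominator {R : realType} (alpha c N : R) :
  conjc (1 + alpha%:C * (c%:C + N%:C * iC)) =
  1 + alpha%:C * (c%:C - N%:C * iC) :> R[i].
Proof.
apply/eqP; rewrite eq_complex /= !mul0r !mulr0 !mulr1 /=.
by rewrite !(subr0, sub0r, add0r, addr0, oppr0) mulrN !eqxx.
Qed.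

Lemma denominator_neq0 {R : realType} (alpha c N : R) : N != 0 ->
  1 + alpha%:C * (c%:C + N%:C * iC) != 0 :> R[i].
Proof.
move=> N0; rewrite eq_complex /= !mul0r !mulr0 !mulr1 /=.
rewrite !(subr0, sub0r, add0r, addr0, oppr0) mulf_eq0 (negPf N0) orbF.
apply/negP => /andP[+ /eqP alpha0]; rewrite alpha0 !mul0r addr0.
exact/negP/oner_neq0.
Qed.

(** The equation on the left defines the line spanned by
    (- alpha, 1 + alpha c). As 1 + e = - 2 i alpha N / conj D and
    1 - e = 2 (1 + alpha c) / conj D, the pair on the right is the multiple
    (2 i N s) / conj D of this generator. *)
Lemma boundary_condition {R : realType} (alpha c N : R) (b v : R[i]) : N != 0 ->
  let D : R[i] := 1 + alpha%:C * (c%:C + N%:C * iC) in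
  let e : R[i] := - (D / conjc D) in
  b + alpha%:C * (v + b * c%:C) = 0 <->
  exists s, b = (1 + e) * s /\ v = iC * (1 - e) * N%:C * s.
Proof.
move=> N0 D e; pose d : R[i] := 1 + alpha%:C * (c%:C - N%:C * iC).
have Dd : conjc D = d by exact: conj_denominator.
have d0 : d != 0 by rewrite -Dd conjc_eq0 denominator_neq0.
have i0 : (iC : R[i]) != 0 by rewrite eq_complex /= oner_eq0 andbF.
have NC0 : N%:C != 0 by rewrite -(inj_eq (@complexI R)) in N0.
rewrite /e Dd; split=> [bc|[s [-> ->]]]; last first.
  by rewrite /D; move: d0; rewrite /d => d0; field.
(* s is half the sum of b = (1 + e) s and v / (i N) = (1 - e) s *)
exists ((b + v / (iC * N%:C)) / 2); split; apply/eqP; rewrite -subr_eq0.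
  rewrite -[X in _ == X](mul0r d^-1) -bc; apply/eqP.
  by rewrite /D; move: d0; rewrite /d => d0; field; rewrite i0 NC0 d0.
rewrite -[X in _ == X](mul0r (- (iC * N%:C / d))) -bc; apply/eqP.
by rewrite /D; move: d0; rewrite /d => d0; field; rewrite i0 NC0 d0.
Qed.

Theorem theorem2p6 (R : realType) (H : completeNormedModType R[i])
    (f : {dot H for Num.conj})
    (norm_inner : forall x : H, `|x| ^+ 2 = inner f x x)
    (A : @operator R H) (A_sa : self_adjoint f A)
    (phi : H -> R[i]) (phi_Hm2 : in_Hm2 f A phi) (phi_notH : ~ in_H f A phi)
    (alpha c : R) :
  let a : R[i] := alpha%:C in
  let g : H := gresolvent f A phi iC in
  let N : R[i] := `|g| ^+ 2 in
  (`|g| = 1 ->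
   rank_one f A phi alpha c =
   T_ext f A phi
     (2^-1 * arg (- ((1 + a * (c%:C - iC)) / (1 + a * (c%:C + iC)))))) /\
  rank_one f A phi alpha c =
  T_ext f A phi
    (2^-1 * arg (- ((1 + a * (c%:C - N * iC)) / (1 + a * (c%:C + N * iC))))).
Proof.
move=> a g N.
suff main : rank_one f A phi alpha c = T_ext f A phi
    (2^-1 * arg (- ((1 + a * (c%:C - N * iC)) / (1 + a * (c%:C + N * iC))))).
  by split=> // g1; rewrite main /N g1 expr1n !mul1r.
have hi := @imaginary_unit_iC R.
set w := - _.
set gm := gresolvent f A phi (- iC).
set p := resolvent A (- iC) g.
have gB : g - gm = (2 * iC) *: p by exact: (gresolventB norm_inner A_sa phi_Hm2).
have phip : phi p = (rnorm g ^+ 2)%:C.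
  exact: (functional_resolvent norm_inner A_sa phi_Hm2).
have Dp : dom A p by exact: (dom_resolvent norm_inner A_sa _ (imaginary_unitN hi)).
have ng : `|gm| = `|g|.
  by rewrite !rnormE (rnorm_gresolventN norm_inner A_sa phi_Hm2).
have g0 : g != 0 by exact: (gresolvent_neq0 norm_inner A_sa phi_Hm2).
have NE : N = (rnorm g ^+ 2)%:C by rewrite rmorphXn /= -rnormE.
pose e := expi (- 2 * (2^-1 * arg w)).
pose h := hvec f A phi.
have span s : (s * `|g|) *: (uplus f A phi + e *: uminus f A phi) =
    ((1 + e) * s) *: h + (iC * (1 - e) * s) *: p.
  have ip : iC *: p = 2^-1 *: (g - gm).
    by rewrite gB scalerA mulrA mulVf ?mul1r// pnatr_eq0.
  have dbl (x : H) : 2^-1 *: (x + x) = x.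
    by rewrite scalerDr -scalerDl (_ : 2^-1 + 2^-1 = 1) ?scale1r//; field.
  have gE : g = h + iC *: p.
    by rewrite ip -scalerDr addrACA subrr addr0 dbl.
  have gmE : gm = h - iC *: p.
    by rewrite ip -scalerBr opprB [g + gm]addrC addrACA subrr addr0 dbl.
  clearbody h; have ng0 : `|g| != 0 by rewrite normr_eq0.
  rewrite /uplus /uminus /unitv -/g -/gm ng scalerA !scalerDr !scalerA mulfK//.
  rewrite (_ : _ * (e * _) = s * e); last by field.
  rewrite [in LHS]gE gmE !scalerDr scalerN -scaleNr !scalerA addrACA.
  by congr (_ + _); rewrite -scalerDl; congr (_ *: _); ring.
have N0 : rnorm g ^+ 2 != 0 by rewrite expf_eq0 rnorm_eq0 g0.
pose D : R[i] := 1 + a * (c%:C + (rnorm g ^+ 2)%:C * iC).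
have D0 : D != 0 by exact: denominator_neq0.
have eE : e = - (D / conjc D).
  rewrite /e mulNr mulVKf ?pnatr_eq0// expi_conj.
  have wE : w = - (conjc D / D) by rewrite /w NE conj_denominator.
  rewrite -expi_arg wE.
    rewrite rmorphN rmorphM.
    by congr (- (_ * _)); [exact: conjcK|exact: conjc_inv].
  rewrite rnormN; apply: complexI.
  by rewrite -rnormE normrM normfV normcJ mulfV ?normr_eq0.
have bc b v := boundary_condition alpha c b v N0.
rewrite /= -/a -/D -eE in bc.
have phiB k y : dom A y -> phi (y + k *: p) = phi y + k * (rnorm g ^+ 2)%:C.
  by move=> Dy; rewrite addrC (functionalZD phi_Hm2)// phip addrC.
have DB k y : dom A y -> dom A (y + k *: p).
  move=> [y' Ay]; have [p' Ap] := Dp; exists (k *: p' + y').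
  by rewrite addrC; exact: (op_lin A_sa).
rewrite /rank_one /T_ext; congr (Defs.restrict _ _); apply/seteqP; split=> x.
  move=> [y [b [Dy -> /bc [s [bs ys]]]]].
  (* as phi p = N, subtracting this multiple of p brings y into the kernel
     of phi *)
  exists (y - (iC * (1 - e) * s) *: p), (s * `|g|); split; last first.
    by rewrite span -bs [_ *: h + _]addrC addrA subrK.
  rewrite -scaleNr; have [y' Ay] := DB (- (iC * (1 - e) * s)) y Dy.
  by exists y'; split => //=; rewrite phiB// ys; ring.
move=> [y [t [[z [Az /= y0]] ->]]].
pose s := t / `|g|.
have -> : t = s * `|g| by rewrite /s divfK// normr_eq0.
exists (y + (iC * (1 - e) * s) *: p), ((1 + e) * s).
have Dy : dom A y by exists z.
split; [exact: DB | by rewrite span [_ *: h + _]addrC addrA |].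
apply/bc; exists s; split => //; rewrite phiB// y0 add0r; ring.
Qed.
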